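(* Let $P$ be a reversible ergodic random walk on a finite state space $X$ with stationary distribution $\pi$. Let $\mathcal{M}=\bigcup_i\mathcal{M}_i\subset X$ be the disjoint union of non-empty subsets $\mathcal{M}_i$ of marked elements. Then the extended hitting time on $\mathcal{M}$ is at most in the order of the weighted average of the extended hitting times of its subsets: $$\mathrm{HT}^{+}(P,\mathcal{M})\in O\left(\sum_i\frac{\epsilon_i}{\epsilon_{\mathcal{M}}}\,\mathrm{HT}^{+}(P,\mathcal{M}_i)\right),$$ where $\epsilon_i=\sum_{x\in\mathcal{M}_i}\pi_x$ and $\epsilon_{\mathcal{M}}=\sum_i\epsilon_i$, and the constant implied by $O$ is universal.
   Context: A random walk on a finite set $X$ of size $N$ is a column-stochastic matrix $P$, with $P_{yx}$ the probability of moving from $x$ to $y$. It is ergodic if its underlying directed graph is strongly connected and aperiodic; then it has a unique stationary distribution $\pi$, with all entries positive. It is reversible if $P_{yx}\pi_x=P_{xy}\pi_y$ for all $x,y$. Write $|\pi\rangle=\sum_{x\in X}\sqrt{\pi_x}\,|x\rangle$. For a marked set $\mathcal{M}$, the absorbing walk $P'$ has $P'_{xx}=1$ and $P'_{yx}=0$ for $y\ne x$ if $x\in\mathcal{M}$, and $P'_{yx}=P_{yx}$ for all $y$ if $x\notin\mathcal{M}$. The hitting time $\mathrm{HT}(P,\mathcal{M})$ is the expected number of steps the walk takes to reach a marked state, when it starts in a state drawn from $\pi$ and halts as soon as it is in a marked state. The interpolated walk is $P(s)=(1-s)P+sP'$ for $0\le s<1$. The discriminant of a walk $Q$ is the real symmetric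 matrix $D(Q)=\sqrt{Q\circ Q^{T}}$ (entrywise product and entrywise square root). For $0\le s<1$ let $\lambda_1(s)=1>\lambda_2(s)\ge\dots\ge\lambda_N(s)$ be the eigenvalues of $D(P(s))$ with orthonormal eigenvectors $|\lambda_k(s)\rangle$. The extended hitting time is the limit $$\mathrm{HT}^{+}(P,\mathcal{M})=\lim_{s\to1^-}\sum_{k=2}^{N}\frac{|\langle\lambda_k(s)|\pi\rangle|^2}{1-\lambda_k(s)}.$$ *)

(* Defs.v *)
From HB Require Import structures.
From mathcomp Require Import all_boot all_order all_algebra.
From mathcomp Require Import all_classical all_reals all_analysis.
Set Implicit Arguments.
Unset Strict Implicit.
Unset Printing Implicit Defensive.
Import Order.TTheory GRing.Theory Num.Theory.
Import numFieldNormedType.Exports.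
Local Open Scope ring_scope.

(* The state space X of size N is 'I_N, and P y x is the
   probability of moving from x to y, so the columns of P sum to 1. *)

Section Walks.
Variables (R : realType) (N : nat).
Implicit Types (P Q : 'M[R]_N) (pi : 'cV[R]_N) (M : {set 'I_N}).

Definition random_walk P : Prop :=
  (forall y x, 0 <= P y x) /\ (forall x, \sum_y P y x = 1).

Definition edge P : rel 'I_N := fun x y => 0 < P y x.

Definition strongly_connected (e : rel 'I_N) : Prop :=
  forall x y, connect e x y.

(* The gcd of the lengths of all closed walks is 1; [cycle e c] allows c to
   repeat vertices, and the empty cycle, of length 0, constrains nothing. *)
Definition aperiodic (e : rel 'I_N) : Prop :=
  forall d : nat, (forall c : seq 'I_N, cycle e c -> (d %| size c)%N) -> d = 1%N.

Definition ergodic P : Prop :=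
  strongly_connected (edge P) /\ aperiodic (edge P).

Definition stationary_distribution P pi : Prop :=
  [/\ forall x, 0 <= pi x 0, \sum_x pi x 0 = 1 & P *m pi = pi].

Definition reversible P pi : Prop :=
  forall x y, P y x * pi x 0 = P x y * pi y 0.

Definition weight pi M : R := \sum_(x in M) pi x 0.

Definition absorbing P M : 'M[R]_N :=
  \matrix_(y, x) if x \in M then (y == x)%:R else P y x.

Definition interpolated P M (s : R) : 'M[R]_N :=
  (1 - s) *: P + s *: absorbing P M.

Definition discriminant Q : 'M[R]_N :=
  \matrix_(x, y) Num.sqrt (Q x y * Q y x).

Definition sqrt_state pi : 'cV[R]_N := \col_x Num.sqrt (pi x 0).

(* The columns of E.2 are orthonormal eigenvectors of D, for the eigenvalues
   listed with multiplicity and in nonincreasing order by E.1. *)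
Definition eigensystem (D : 'M[R]_N) (E : 'rV[R]_N * 'M[R]_N) : Prop :=
  [/\ forall j k : 'I_N, (j <= k)%N -> E.1 0 k <= E.1 0 j,
      E.2^T *m E.2 = 1%:M &
      forall k, D *m col k E.2 = E.1 0 k *: col k E.2].

(* Some eigensystem of D: one exists as soon as D is symmetric, and the default
   value (0, 0) is only taken for matrices D that have none. *)
Definition eigen (D : 'M[R]_N) : 'rV[R]_N * 'M[R]_N :=
  xget (0, 0) [set E | eigensystem D E]%classic.

(* Eigenvalues are indexed from 0, so the sum over k >= 2 becomes 0 < k.  The
   value does not depend on the eigensystem chosen when the largest eigenvalue
   is simple, as it is for the discriminant of a reversible ergodic walk. *)
Definition spectral_sum (D : 'M[R]_N) (v : 'cV[R]_N) : R :=
  let E := eigen D in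
  \sum_(k < N | (0 < k)%N)
    `| ((col k E.2)^T *m v) 0 0 | ^+ 2 / (1 - E.1 0 k).

(* pi stands for the stationary distribution of P, also when the discriminant
   is that of the interpolated walk; the limit is from the left. *)
Definition extended_hitting_time P pi M : R :=
  lim (spectral_sum (discriminant (interpolated P M s)) (sqrt_state pi)
        @[s --> (1 : R)^'-])%classic.

End Walks.

(* Main.v *)
Require Import Defs.
From HB Require Import structures.
From mathcomp Require Import all_boot all_order all_algebra.
From mathcomp Require Import all_classical all_reals all_analysis.
From mathcomp Require Import perm complex ring lra.
Set Implicit Arguments.
Unset Strict Implicit.
Unset Printing Implicit Defensive.
Import Order.TTheory GRing.Theory Num.Theory.
Import numFieldNormedType.Exports.
Local Open Scope ring_scope.

(* Let L = 1 - D(P), v the square-root state of pi, e the weight of M, m the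
   restriction of v to M, and S the diagonal matrix with entry r = sqrt (1 - s)
   on M and 1 elsewhere.  Then 1 - D(P(s)) = S L S.  With <x, L^+ x> standing
   for <h, L h> where L h = x, this turns the spectral sum into
     ((1 - r) / (e + r^2 (1 - e)))^2 <z, L^+ z>  with  z = e v - m,
   so the extended hitting time on M is <z, L^+ z> / e^2.  As z is additive over
   disjoint unions and L is positive semidefinite, the bound is the
   Cauchy-Schwarz inequality, and the constant 1 works. *)

(** * Quadratic forms and a weighted Cauchy-Schwarz inequality *)

Lemma trmx11 (T : Type) (X : 'M[T]_1) : X^T = X.
Proof. by apply/matrixP => i j; rewrite !ord1 mxE. Qed.

Lemma dotmx_ge0 (R : realDomainType) n (u : 'rV[R]_n) : 0 <= (u *m u^T) 0 0.
Proof. by rewrite mxE sumr_ge0// => k _; rewrite mxE -expr2 sqr_ge0. Qed.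

Lemma dotmx_eq0 (R : realDomainType) n (u : 'rV[R]_n) :
  ((u *m u^T) 0 0 == 0) = (u == 0).
Proof.
apply/eqP/eqP => [|->]; last by rewrite mul0mx mxE.
rewrite mxE => /eqP; rewrite psumr_eq0 => [/allP u0|k _]; last first.
  by rewrite mxE -expr2 sqr_ge0.
apply/rowP => k; rewrite mxE; apply/eqP.
by have := u0 k (mem_index_enum k); rewrite mxE -expr2 sqrf_eq0.
Qed.

Definition qform (R : realType) n (B : 'M[R]_n) (x : 'cV[R]_n) : R :=
  (x^T *m B *m x) 0 0.

Lemma qformE (R : realType) n (B : 'M[R]_n) (x : 'cV[R]_n) :
  qform B x = \sum_i \sum_j x i 0 * B i j * x j 0.
Proof.
rewrite /qform mxE exchange_big; apply: eq_bigr => j _.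
by rewrite mxE mulr_suml; apply: eq_bigr => i _; rewrite mxE.
Qed.

Lemma qformZ (R : realType) n (B : 'M[R]_n) (a : R) x :
  qform B (a *: x) = a ^+ 2 * qform B x.
Proof.
by rewrite /qform [(_ *: _)^T]linearZ -!scalemxAl -scalemxAr scalerA mxE expr2.
Qed.

Lemma qform_comb (R : realType) n (B : 'M[R]_n) (a b : R) x y : B^T = B ->
  qform B (a *: x - b *: y) =
  a ^+ 2 * qform B x - 2 * a * b * (y^T *m B *m x) 0 0 + b ^+ 2 * qform B y.
Proof.
move=> B_sym; have xy : (x^T *m B *m y) 0 0 = (y^T *m B *m x) 0 0.
  by rewrite -[x^T *m B *m y]trmx11 (trmx_mul (x^T *m B)) (trmx_mul x^T) trmxK B_sym
             mulmxA.
have tr_comb : (a *: x - b *: y)^T = a *: x^T - b *: y^T.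
  by rewrite linearB/= !linearZ.
have ent (X Y : 'M[R]_1) : (X - Y) 0 0 = X 0 0 - Y 0 0 by rewrite !mxE.
have entZ c (X : 'M[R]_1) : (c *: X) 0 0 = c * X 0 0 by rewrite mxE.
rewrite /qform tr_comb mulmxBr !mulmxBl -!scalemxAr -!scalemxAl.
by rewrite !(ent, entZ) xy; ring.
Qed.

(** The weighted variance of the vectors [h i / e i] about their mean [H / E], measured by the form,
    is nonnegative; expanding it gives the bound. *)
Lemma psd_form_sum_le (R : realType) n (B : 'M[R]_n) (I : finType)
    (h : I -> 'cV[R]_n) (e : I -> R) :
  B^T = B -> (forall x, 0 <= qform B x) -> (forall i, 0 < e i) ->
  qform B (\sum_i h i) <= (\sum_i e i) * \sum_i qform B (h i) / e i.
Proof.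
move=> B_sym B_ge0 e_gt0; set H := \sum_i h i; set E := \sum_i e i.
have [i0 _|I0] := pickP (fun _ : I => true); last first.
  by rewrite /H /E !big_pred0// mul0r /qform mulmx0 mxE.
have E_gt0 : 0 < E.
  by rewrite /E (bigD1 i0)//= ltr_pwDl// sumr_ge0// => i _; rewrite ltW.
have expand i : e i * qform B ((e i)^-1 *: h i - E^-1 *: H) =
    qform B (h i) / e i - 2 / E * (H^T *m B *m h i) 0 0 + e i / E ^+ 2 * qform B H.
  by rewrite qform_comb//; field; rewrite !gt_eqF.
have : 0 <= \sum_i e i * qform B ((e i)^-1 *: h i - E^-1 *: H).
  by rewrite sumr_ge0// => i _; rewrite mulr_ge0// ltW.
rewrite (eq_bigr _ (fun i _ => expand i)) big_split sumrB /= -mulr_sumr -!mulr_suml.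
have -> : \sum_i (H^T *m B *m h i) 0 0 = qform B H.
  by rewrite /qform -/H {3}/H mulmx_sumr summxE.
rewrite -/E => le0; rewrite -ler_pdivrMl//.
suff -> : E^-1 * qform B H = 2 / E * qform B H - E / E ^+ 2 * qform B H by lra.
by field; rewrite gt_eqF.
Qed.

(** * Orthogonal diagonalization of real symmetric matrices *)

Section RealSpectral.
Variables (R : rcfType) (n : nat) (A : 'M[R]_n).
Hypothesis A_sym : A^T = A.

Lemma sym_eigenvector_stable m (B : 'M[R]_(m, n)) :
  (0 < m)%N -> row_free B -> stablemx B A ->
  exists (a : R) (v : 'rV[R]_n), [/\ v != 0, (v <= B)%MS & v *m A = a *: v].
Proof.
(* The real and imaginary parts of a complex eigenvector are real eigenvectors
   or zero, because the eigenvalue is real. *)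
move=> m_gt0 freeB /submxP[M BA].
have [a /eigenvalueP[u uM u0]] :=
  eigenvalue_closed (map_mx (real_complex R) M) m_gt0.
pose ur := map_mx (@complex.Re R) u; pose ui := map_mx (@complex.Im R) u.
have Rem : map_mx (@complex.Re R) (u *m map_mx (real_complex R) M) = ur *m M.
  apply/rowP => j; rewrite !mxE raddf_sum; apply: eq_bigr => k _.
  by rewrite !mxE; case: (u 0 k) => x y /=; rewrite !mulr0 subr0.
have Imm : map_mx (@complex.Im R) (u *m map_mx (real_complex R) M) = ui *m M.
  apply/rowP => j; rewrite !mxE raddf_sum; apply: eq_bigr => k _.
  by rewrite !mxE; case: (u 0 k) => x y /=; rewrite mulr0 add0r.
have urM : ur *m M = complex.Re a *: ur - complex.Im a *: ui.
  rewrite -Rem uM; apply/rowP => j; rewrite !mxE.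
  by case: (a) (u 0 j) => ? ? [].
have uiM : ui *m M = complex.Im a *: ur + complex.Re a *: ui.
  rewrite -Imm uM; apply/rowP => j; rewrite !mxE.
  by case: (a) (u 0 j) => ? ? [? ?] /=; rewrite addrC.
set x := ur *m B; set y := ui *m B.
have xA : x *m A = complex.Re a *: x - complex.Im a *: y.
  by rewrite /x -mulmxA BA mulmxA urM mulmxBl -!scalemxAl.
have yA : y *m A = complex.Im a *: x + complex.Re a *: y.
  by rewrite /y -mulmxA BA mulmxA uiM mulmxDl -!scalemxAl.
have xy0 : (x != 0) || (y != 0).
  rewrite -negb_and; apply: contra u0 => /andP[/eqP x0 /eqP y0].
  have ur0 : ur = 0 by apply: (row_free_inj freeB); rewrite mul0mx.
  have ui0 : ui = 0 by apply: (row_free_inj freeB); rewrite mul0mx.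
  apply/eqP/rowP => j; move/rowP/(_ j): ur0; move/rowP/(_ j): ui0.
  by rewrite !mxE; case: (u 0 j) => ? ? /= -> ->.
(* Symmetry equates [x A y^T] with [y A x^T], which leaves [Im a (|x|^2 + |y|^2) = 0]. *)
have a0 : complex.Im a = 0.
  have e : (x *m A *m y^T) 0 0 = (y *m A *m x^T) 0 0.
    by rewrite -[x *m A *m _]trmx11 (trmx_mul (x *m A)) (trmx_mul x) trmxK A_sym
               mulmxA.
  have c : (x *m y^T) 0 0 = (y *m x^T) 0 0.
    by rewrite -[x *m _]trmx11 (trmx_mul x) trmxK.
  move: e; rewrite xA yA mulmxBl mulmxDl -!scalemxAl.
  rewrite [in LHS]mxE [X in _ + X]mxE [X in X - _]mxE [X in _ - X]mxE.
  rewrite [in RHS]mxE [X in _ = X + _]mxE [X in _ = _ + X]mxE c.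
  have x_ge0 := dotmx_ge0 x; have y_ge0 := dotmx_ge0 y => e.
  have /eqP : complex.Im a * ((x *m x^T) 0 0 + (y *m y^T) 0 0) = 0 by lra.
  rewrite mulf_eq0 paddr_eq0// !dotmx_eq0 => /orP[/eqP//|].
  by rewrite -[_ && _]negbK negb_and xy0.
exists (complex.Re a); case/orP: xy0 => [x0|y0]; [exists x|exists y]; split=> //.
- exact: submxMl.
- by rewrite xA a0 scale0r subr0.
- exact: submxMl.
- by rewrite yA a0 scale0r add0r.
Qed.

(** Induction on [k]: the orthogonal complement of the rows found so far has positive dimension when
    [k < n] and is stable under [A] by symmetry, so it contains a further eigenvector, which is
    normalized and added. The case [k = n] is the spectral theorem. *)
Lemma sym_orthonormal_rows k : (k <= n)%N ->
  exists (Q : 'M[R]_(k, n)) (d : 'rV[R]_k),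
    Q *m Q^T = 1%:M /\ Q *m A = diag_mx d *m Q.
Proof.
elim: k => [_|k IHk kn].
  by exists 0, 0; split; apply/matrixP => -[].
have [Q [d [QQ QA]]] := IHk (ltnW kn).
have rQ : \rank Q = k.
  by apply/eqP; rewrite -[_ == _]/(row_free Q); apply/row_freeP; exists Q^T.
pose K := kermx Q^T.
have K_gt0 : (0 < \rank K)%N by rewrite mxrank_ker mxrank_tr rQ subn_gt0.
have Kst : stablemx (row_base K) A.
  rewrite eq_row_base; apply/sub_kermxP.
  have -> : row_base K *m A *m Q^T = row_base K *m Q^T *m diag_mx d.
    by rewrite -[A]A_sym -!mulmxA -trmx_mul QA trmx_mul tr_diag_mx.
  rewrite (_ : row_base K *m Q^T = 0) ?mul0mx//.
  by apply/sub_kermxP; rewrite eq_row_base.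
have [a [v [v0 vK vA]]] := sym_eigenvector_stable K_gt0 (row_base_free K) Kst.
have vQ : v *m Q^T = 0 by apply/sub_kermxP; move: vK; rewrite eq_row_base.
pose c := (v *m v^T) 0 0.
have c_gt0 : 0 < c by rewrite lt0r dotmx_eq0 v0 dotmx_ge0.
pose w := (Num.sqrt c)^-1 *: v.
have ww : w *m w^T = 1%:M.
  rewrite /w linearZ -scalemxAl -scalemxAr scalerA -invfM -expr2 sqr_sqrtr ?ltW//.
  apply/matrixP => i j; rewrite !ord1 !mxE -/c eqxx.
  have -> : \sum_j v 0 j * v^T j 0 = c by rewrite /c mxE.
  by rewrite mulVf ?gt_eqF.
have wQ : w *m Q^T = 0 by rewrite -scalemxAl vQ scaler0.
have wA : w *m A = a *: w by rewrite -scalemxAl vA scalerA mulrC -scalerA.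
rewrite -[k.+1]/(1 + k)%N; exists (col_mx w Q), (row_mx a%:M d); split.
  rewrite tr_col_mx mul_col_row ww QQ wQ.
  by rewrite -[Q *m w^T]trmxK trmx_mul trmxK wQ trmx0 -scalar_mx_block.
rewrite mul_col_mx QA wA diag_mx_row mul_block_col !mul0mx addr0 add0r.
rewrite (_ : diag_mx a%:M = a%:M) ?mul_scalar_mx//.
by apply/matrixP => i j; rewrite !ord1 !mxE eqxx.
Qed.

End RealSpectral.

(** Sorting by the reversed order matches the nonincreasing order that [eigensystem] demands; a
    permutation is needed to move the eigenvectors along with their eigenvalues. *)
Lemma sorting_perm d (T : orderType d) n (f : 'I_n -> T) :
  exists s : 'S_n, forall j k : 'I_n, (j <= k)%N -> (f (s k) <= f (s j))%O.
Proof.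
pose t := sort_tuple (fun x y : T => (y <= x)%O) [tuple f i | i < n].
have /tuple_permP[s ts] : perm_eq t [tuple f i | i < n] by rewrite perm_sort.
have st : sorted (fun x y : T => (y <= x)%O) t.
  by apply: sort_sorted => x y; exact: le_total.
exists s => j k jk.
have fE (i : 'I_n) : f (s i) = nth (f j) t i.
  by rewrite ts nth_mktuple tnth_mktuple.
have tr : transitive (fun x y : T => (y <= x)%O).
  by move=> y x z xy yz; exact: le_trans yz xy.
have := sorted_leq_nth tr (fun x => lexx x) (f j) st.
by move=> /(_ j k); rewrite !inE size_tuple !ltn_ord => /(_ isT isT jk);
  rewrite !fE.
Qed.

(** * Eigensystems and the spectral sum *)

Section Spectral.
Variables (R : realType) (n : nat).
Implicit Types A B : 'M[R]_n.

(** Ensures that [eigen] of a symmetric matrix is a genuine eigensystem and not the default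
    value. *)
Lemma sym_eigensystem A : A^T = A -> exists E, eigensystem A E.
Proof.
move=> A_sym; have [Q [d [QQ QA]]] := sym_orthonormal_rows A_sym (leqnn n).
have [s sd] := sorting_perm (fun i => d 0 i).
exists (\row_i d 0 (s i), \matrix_(i, j) Q (s j) i); split=> /=.
- by move=> j k jk; rewrite !mxE; exact: sd.
- apply/matrixP => i j; rewrite !mxE.
  have /matrixP/(_ (s i) (s j)) := QQ; rewrite !mxE (inj_eq perm_inj) => <-.
  by apply: eq_bigr => k _; rewrite !mxE.
- move=> k; apply/colP => i; rewrite !mxE.
  have /matrixP/(_ (s k) i) := QA; rewrite mul_diag_mx !mxE => <-.
  by apply: eq_bigr => j _; rewrite !mxE -{1}A_sym !mxE mulrC.
Qed.

Lemma normcv_eq0 (x : 'cV[R]_n) : ((x^T *m x) 0 0 == 0) = (x == 0).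
Proof.
by rewrite -{2}[x]trmxK dotmx_eq0 -[x in RHS]trmxK -(inj_eq trmx_inj) trmxK trmx0.
Qed.

(* With [B = 1 - A], this says that the spectral sum is [<v, B^+ v>] for the
   pseudo-inverse [B^+] of [B]; [f] is a preimage under [B] of the component of
   [v] orthogonal to the kernel, which is spanned by [w]. *)
Lemma spectral_sumE A (v w f : 'cV[R]_n) (c : R) :
  A^T = A -> (forall x, 0 <= qform (1%:M - A) x) ->
  w != 0 -> (1%:M - A) *m w = 0 ->
  (forall x, (1%:M - A) *m x = 0 -> exists b, x = b *: w) ->
  v = (1%:M - A) *m f + c *: w ->
  spectral_sum A v = qform (1%:M - A) f.
Proof.
move=> A_sym B_ge0 w0 Bw kerB vE; rewrite /spectral_sum.
have : eigensystem A (eigen A).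
  by have [E AE] := sym_eigensystem A_sym; exact: (xgetPex _ (ex_intro _ E AE)).
case: (eigen A) => l Q [/= l_sorted QQ AQ]; set B := 1%:M - A.
pose e k := col k Q.
have B_sym : B^T = B by rewrite /B linearB/= A_sym trmx1.
have Be k : B *m e k = (1 - l 0 k) *: e k.
  by rewrite /B mulmxBl mul1mx AQ scalerBl scale1r.
have eB k (x : 'cV_n) : ((e k)^T *m (B *m x)) 0 0 = (1 - l 0 k) * ((e k)^T *m x) 0 0.
  by rewrite mulmxA -[B]B_sym -trmx_mul Be linearZ -scalemxAl mxE.
have ee j k : ((e j)^T *m e k) 0 0 = (j == k)%:R.
  have /matrixP/(_ j k) := QQ; rewrite !mxE => <-.
  by apply: eq_bigr => i _; rewrite !mxE.
have l_le1 k : l 0 k <= 1.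
  rewrite -subr_ge0; have := B_ge0 (e k).
  by rewrite /qform -/B -mulmxA eB ee eqxx mulr1.
have ew k : (1 - l 0 k) * ((e k)^T *m w) 0 0 = 0 by rewrite -eB Bw mulmx0 mxE.
(* The nonzero [w] has a nonzero coordinate along some [e k], and [ew] forces the eigenvalue there
   to be 1. *)
have [k0 lk0] : exists k0, l 0 k0 = 1.
  have : Q^T *m w != 0.
    apply: contra w0 => /eqP Qw.
    by rewrite -[w]mul1mx -(mulmx1C QQ) -mulmxA Qw mulmx0.
  case/cV0Pn => k Qw; exists k; move/eqP: (ew k).
  have -> : ((e k)^T *m w) 0 0 = (Q^T *m w) k 0.
    by rewrite !mxE; apply: eq_bigr => i _; rewrite !mxE.
  by rewrite mulf_eq0 (negPf Qw) orbF subr_eq0 => /eqP.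
have l0 (k : 'I_n) : val k = 0%N -> l 0 k = 1.
  move=> k_0; apply/eqP; rewrite eq_le l_le1/= -lk0 l_sorted//.
  by move: k_0 => /= ->.
(* Eigenvalue 1 is simple: two orthonormal eigenvectors for it would both be multiples of [w]. *)
have l_lt1 (k : 'I_n) : (0 < k)%N -> l 0 k != 1.
  move=> k_gt0; apply/eqP => lk; pose z := Ordinal (ltn_trans k_gt0 (ltn_ord k)).
  have [|b ez] := kerB (e z); first by rewrite -/B Be l0// subrr scale0r.
  have [|b' ek] := kerB (e k); first by rewrite -/B Be lk subrr scale0r.
  have := ee z k; have -> : (z == k) = false.
    by apply/negbTE; rewrite -val_eqE/= neq_ltn k_gt0.
  rewrite ez ek [(_ *: _)^T]linearZ -scalemxAl -scalemxAr scalerA mxE => /eqP.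
  rewrite mulf_eq0 normcv_eq0 (negPf w0) orbF mulf_eq0 => /orP[]/eqP b0.
    by have /eqP := ee z z; rewrite ez b0 scale0r mulmx0 mxE eqxx eq_sym oner_eq0.
  by have /eqP := ee k k; rewrite ek b0 scale0r mulmx0 mxE eqxx eq_sym oner_eq0.
(* The form at [f] is expanded in the eigenbasis. The term of index 0 vanishes; for the others [e k]
   is orthogonal to [w], so the coordinate of [v] is [1 - l 0 k] times that of [f]. *)
transitivity (\sum_k (1 - l 0 k) * (((e k)^T *m f) 0 0) ^+ 2); last first.
  rewrite /qform -mulmxA -[f^T]mulmx1 -(mulmx1C QQ) -!mulmxA mulmxA mxE.
  apply: eq_bigr => k _.
  have -> : (f^T *m Q) 0 k = ((e k)^T *m f) 0 0.
    by rewrite !mxE; apply: eq_bigr => i _; rewrite !mxE mulrC.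
  have -> : (Q^T *m (B *m f)) k 0 = ((e k)^T *m (B *m f)) 0 0.
    by rewrite [LHS]mxE [RHS]mxE; apply: eq_bigr => i _; rewrite !mxE.
  by rewrite eB; ring.
rewrite [RHS](bigID (fun k : 'I_n => (0 < k)%N))/= [X in _ = _ + X]big1 ?addr0; last first.
  by move=> k; rewrite lt0n negbK => /eqP k_0; rewrite l0// subrr mul0r.
apply: eq_bigr => k k_gt0; rewrite -/(e k) vE mulmxDr -scalemxAr.
have ew0 : ((e k)^T *m w) 0 0 = 0.
  by move/eqP: (ew k); rewrite mulf_eq0 subr_eq0 eq_sym (negPf (l_lt1 k k_gt0)) => /eqP.
have lk : 1 - l 0 k != 0 by rewrite subr_eq0 eq_sym l_lt1.
rewrite mxE eB [X in _ + X]mxE ew0 mulr0 addr0 real_normK ?num_real//.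
by field.
Qed.

End Spectral.

(** * The discriminant of a reversible walk and its Laplacian *)

Lemma discriminant_sym (R : realType) n (Q : 'M[R]_n) :
  (discriminant Q)^T = discriminant Q.
Proof. by apply/matrixP => i j; rewrite !mxE mulrC. Qed.

Section ReversibleWalk.
Variables (R : realType) (N : nat) (P : 'M[R]_N) (pi : 'cV[R]_N).
Hypotheses (P_walk : random_walk P) (P_conn : strongly_connected (edge P)).
Hypotheses (pi_stat : stationary_distribution P pi) (P_rev : reversible P pi).

Local Notation v := (sqrt_state pi).
Local Notation D := (discriminant P).

Lemma sum_flow x : \sum_y P x y * pi y 0 = pi x 0.
Proof. by case: pi_stat => _ _ /matrixP/(_ x 0); rewrite mxE. Qed.

(** Some entry is positive because the sum is 1; stationarity carries positivity along edges, and
    strong connectivity spreads it to every state. *)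
Lemma stationary_gt0 x : 0 < pi x 0.
Proof.
have [P_ge0 _] := P_walk; have [pi_ge0 pi_sum _] := pi_stat.
have [x0 x0_gt0] : exists x0, 0 < pi x0 0.
  apply/not_existsP => pi_le0; move/eqP: pi_sum.
  rewrite big1 ?(eq_sym 0) ?oner_eq0// => y _.
  by apply/eqP; rewrite eq_le pi_ge0 andbT leNgt; apply/negP/pi_le0.
have step a b : edge P a b -> 0 < pi a 0 -> 0 < pi b 0.
  rewrite /edge => ab a_gt0; rewrite -(sum_flow b) (bigD1 a)//=.
  by rewrite ltr_pwDl ?mulr_gt0// sumr_ge0// => y _; rewrite mulr_ge0.
have /connectP[p] := P_conn x0 x.
elim: p x0 x0_gt0 => [|y p IHp] a a_gt0 /= => [_ ->//|].
by case/andP => /step/(_ a_gt0); exact: IHp.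
Qed.

Let v_gt0 x : 0 < v x 0. Proof. by rewrite mxE sqrtr_gt0 stationary_gt0. Qed.

Let v_neq0 x : v x 0 != 0. Proof. by rewrite gt_eqF. Qed.

Lemma sqrt_state_sqr x : v x 0 ^+ 2 = pi x 0.
Proof. by rewrite mxE sqr_sqrtr// ltW// stationary_gt0. Qed.

(** Reversibility turns the product under the root, once multiplied by [pi x * pi y], into a perfect
    square. So [D] is [P] conjugated by the diagonal matrix of [v]. *)
Lemma discriminant_flow x y : D x y = P x y * pi y 0 / (v x 0 * v y 0).
Proof.
have [P_ge0 _] := P_walk; have [pi_ge0 _ _] := pi_stat.
apply: (mulIf (mulf_neq0 (v_neq0 x) (v_neq0 y))).
rewrite divfK ?mulf_neq0// ![v _ _]mxE mxE -!sqrtrM ?mulr_ge0 ?pi_ge0//.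
rewrite (_ : P x y * P y x * _ = (P x y * pi y 0) ^+ 2); last first.
  by rewrite expr2 -{2}P_rev; ring.
by rewrite sqrtr_sqr ger0_norm// mulr_ge0.
Qed.

(** This is the Dirichlet form of the function [x / v]. When the square is expanded, both square
    terms sum to [|x|^2], since the flow [F] has marginal [pi] on each side, by stationarity and
    reversibility. *)
Lemma qform_laplacian x :
  qform (1%:M - D) x =
  2^-1 * \sum_a \sum_b P a b * pi b 0 * (x a 0 / v a 0 - x b 0 / v b 0) ^+ 2.
Proof.
pose f a := x a 0 / v a 0; pose F a b := P a b * pi b 0.
have pif a : pi a 0 * f a ^+ 2 = x a 0 ^+ 2.
  by rewrite -sqrt_state_sqr /f; field.
have -> : \sum_a \sum_b P a b * pi b 0 * (x a 0 / v a 0 - x b 0 / v b 0) ^+ 2 =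
    \sum_a x a 0 ^+ 2 + \sum_b x b 0 ^+ 2 - 2 * \sum_a \sum_b F a b * (f a * f b).
  have e1 : \sum_a x a 0 ^+ 2 = \sum_a \sum_b F a b * f a ^+ 2.
    by apply: eq_bigr => a _; rewrite -mulr_suml sum_flow pif.
  have e2 : \sum_b x b 0 ^+ 2 = \sum_a \sum_b F a b * f b ^+ 2.
    rewrite exchange_big; apply: eq_bigr => b _.
    by rewrite -pif -sum_flow mulr_suml; apply: eq_bigr => a _; rewrite -P_rev.
  rewrite {1}e1 e2 mulr_sumr -big_split -sumrB; apply: eq_bigr => a _ /=.
  rewrite mulr_sumr -big_split -sumrB; apply: eq_bigr => b _ /=.
  by rewrite /F /f; ring.
rewrite qformE.
have -> : \sum_i \sum_j x i 0 * (1%:M - D) i j * x j 0 =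
    \sum_i x i 0 ^+ 2 - \sum_a \sum_b F a b * (f a * f b).
  rewrite -sumrB; apply: eq_bigr => a _.
  have -> : x a 0 ^+ 2 = \sum_b (a == b)%:R * (x a 0 * x b 0).
    rewrite (bigD1 a)//= eqxx mul1r big1 ?addr0// => b.
    by rewrite eq_sym => /negPf ->; rewrite mul0r.
  rewrite -sumrB; apply: eq_bigr => b _.
  rewrite [(1%:M - D) a b]mxE [(- D) a b]mxE [1%:M a b]mxE discriminant_flow /F /f.
  by field; rewrite !v_neq0.
by field.
Qed.

Lemma laplacian_ge0 x : 0 <= qform (1%:M - D) x.
Proof.
have [P_ge0 _] := P_walk; have [pi_ge0 _ _] := pi_stat.
rewrite qform_laplacian mulr_ge0 ?invr_ge0// sumr_ge0// => a _.
by rewrite sumr_ge0// => b _; rewrite mulr_ge0 ?sqr_ge0 ?mulr_ge0.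
Qed.

Lemma laplacian_sqrt_state : (1%:M - D) *m v = 0.
Proof.
apply/eqP; rewrite mulmxBl mul1mx subr_eq0 eq_sym; apply/eqP/colP => a.
have -> : (D *m v) a 0 = pi a 0 / v a 0.
  rewrite mxE -sum_flow mulr_suml; apply: eq_bigr => b _.
  by rewrite discriminant_flow; field; rewrite !v_neq0.
by rewrite -sqrt_state_sqr; field.
Qed.

(** Every term of the Dirichlet form vanishes, so [x / v] is constant along edges, hence constant by
    connectivity. *)
Lemma laplacian_ker x : qform (1%:M - D) x = 0 -> exists c, x = c *: v.
Proof.
have [P_ge0 _] := P_walk; have [pi_ge0 _ _] := pi_stat.
move/eqP; rewrite qform_laplacian mulf_eq0 invr_eq0 pnatr_eq0/=.
have F_ge0 a b : 0 <= P a b * pi b 0 * (x a 0 / v a 0 - x b 0 / v b 0) ^+ 2.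
  by rewrite mulr_ge0 ?sqr_ge0 ?mulr_ge0.
rewrite psumr_eq0 => [/allP F0|a _]; last exact: sumr_ge0.
have step a b : edge P a b -> x a 0 / v a 0 = x b 0 / v b 0.
  rewrite /edge => ab; have := F0 b (mem_index_enum b).
  rewrite psumr_eq0 => [/allP/(_ a (mem_index_enum a))|c _]; last exact: F_ge0.
  rewrite /= mulf_eq0 sqrf_eq0 mulf_eq0 (gt_eqF ab) gt_eqF ?stationary_gt0//=.
  by rewrite subr_eq0 => /eqP.
have conn a b : x a 0 / v a 0 = x b 0 / v b 0.
  have /connectP[p] := P_conn a b.
  elim: p a => [|y p IHp] a /= => [_ ->//|].
  by case/andP => /step -> /IHp; exact.
have [x0|a] := pickP (fun _ : 'I_N => true); last first.
  by exists 0; apply/colP => b; have := a b.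
exists (x x0 0 / v x0 0); apply/colP => b; rewrite mxE.
by rewrite (conn x0 b) divfK.
Qed.

End ReversibleWalk.

(** * Interpolated walks and the extended hitting time *)

Section HittingTime.
Variables (R : realType) (N : nat) (P : 'M[R]_N) (pi : 'cV[R]_N).
Hypotheses (P_walk : random_walk P) (P_conn : strongly_connected (edge P)).
Hypotheses (pi_stat : stationary_distribution P pi) (P_rev : reversible P pi).
Implicit Type M : {set 'I_N}.

Local Notation v := (sqrt_state pi).
Local Notation L := (1%:M - discriminant P).

Let v_neq0 : v != 0.
Proof.
apply/eqP => v0; have [_ /eqP + _] := pi_stat.
rewrite big1 ?(eq_sym 0) ?oner_eq0// => x _.
by rewrite -(sqrt_state_sqr P_walk P_conn pi_stat) v0 mxE expr0n.
Qed.

Definition rescaling M (r : R) : 'M[R]_N :=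
  diag_mx (\row_x if x \in M then r else 1).

Lemma laplacian_interpolated M (s : R) : 0 <= s -> s < 1 ->
  1%:M - discriminant (interpolated P M s) =
  rescaling M (Num.sqrt (1 - s)) *m L *m rescaling M (Num.sqrt (1 - s)).
Proof.
move=> s0 s1; have [P_ge0 _] := P_walk.
have r2 : Num.sqrt (1 - s) ^+ 2 = 1 - s by rewrite sqr_sqrtr// subr_ge0 ltW.
pose c x := if x \in M then Num.sqrt (1 - s) else 1.
have c_ge0 x : 0 <= c x by rewrite /c; case: ifP.
apply/matrixP => x y; rewrite mul_mx_diag mul_diag_mx !mxE -/(c x) -/(c y).
(* On the diagonal, a marked state gives [1 - ((1 - s) P x x + s) = (1 - s) (1 - P x x)]. Off it,
   absorption scales the column of a marked state by [1 - s], that is, column [y] by [c y ^+ 2]. *)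
have [<-|xy] := eqVneq x y.
  rewrite -!expr2 !sqrtr_sqr /c (ger0_norm (P_ge0 _ _)).
  case: ifP => _; rewrite ger0_norm/=.
  - by rewrite mulrAC -expr2 r2; ring.
  - by rewrite addr_ge0 ?mulr_ge0// subr_ge0 ltW.
  - by rewrite mul1r mulr1; ring.
  - by rewrite addr_ge0 ?mulr_ge0// subr_ge0 ltW.
rewrite !sub0r mulrN mulNr; congr (- _).
rewrite [X in Num.sqrt X = _](_ : _ = (c x * c y) ^+ 2 * (P x y * P y x)); last first.
  rewrite exprMn /c.
  by case: (x \in M); case: (y \in M); rewrite ?r2 ?expr1n /=; ring.
by rewrite sqrtrM ?sqr_ge0// sqrtr_sqr ger0_norm ?mulr_ge0//; ring.
Qed.

Definition marked_state M : 'cV[R]_N := \col_x if x \in M then v x 0 else 0.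

(* Minus the component of [marked_state M] orthogonal to [v], as the inner
   product of [v] and [marked_state M] is [weight pi M]. *)
Definition centered_state M : 'cV[R]_N := weight pi M *: v - marked_state M.

Lemma sqrt_state_norm : (v^T *m v) 0 0 = 1.
Proof.
have [_ <- _] := pi_stat; rewrite mxE; apply: eq_bigr => x _.
by rewrite [v^T _ _]mxE -expr2 (sqrt_state_sqr P_walk P_conn pi_stat).
Qed.

Lemma centered_state_orth M : v^T *m centered_state M = 0.
Proof.
apply/matrixP => i j; rewrite !ord1 mulmxBr -scalemxAr.
have -> : v^T *m marked_state M = (weight pi M)%:M.
  apply/matrixP => i' j'; rewrite !ord1 !mxE mulr1n /weight [RHS]big_mkcond.
  apply: eq_bigr => x _; rewrite [v^T _ _]mxE [marked_state _ _ _]mxE.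
  by case: ifP => _; rewrite ?mulr0// -expr2 (sqrt_state_sqr P_walk P_conn pi_stat).
by rewrite [LHS]mxE [X in X + _]mxE sqrt_state_norm !mxE mulr1 mulr1n subrr.
Qed.

(** The range of the symmetric [L] is the orthogonal complement of its kernel, the line of [v].
    Adding the projector on [v] yields an invertible [G], and a solution of [G h = z] is orthogonal
    to [v], so [G] acts on it as [L]. *)
Lemma laplacian_preimage (z : 'cV[R]_N) : v^T *m z = 0 -> exists h, L *m h = z.
Proof.
move=> vz; pose G := L + v *m v^T.
have Lv := laplacian_sqrt_state P_walk P_conn pi_stat P_rev.
have L_sym : L^T = L by rewrite linearB/= trmx1 discriminant_sym.
have vL : v^T *m L = 0 by rewrite -[L]L_sym -trmx_mul Lv trmx0.
have vv : v^T *m v = 1%:M.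
  by apply/matrixP => i j; rewrite !ord1 sqrt_state_norm mxE.
have GE (x : 'cV_N) : G *m x = L *m x + v *m (v^T *m x) by rewrite mulmxA -mulmxDl.
have vG : v^T *m G = v^T by rewrite mulmxDr vL add0r mulmxA vv mul1mx.
have G_unit : G \in unitmx.
  rewrite -unitmx_tr -row_free_unit -kermx_eq0; apply/eqP/row_matrixP => i.
  set u := row i _; rewrite row0.
  have : u *m G^T = 0 by apply/sub_kermxP; rewrite row_sub.
  rewrite -[u]trmxK -trmx_mul -[0]trmxK => /trmx_inj; rewrite trmx0.
  set x := u^T => Gx.
  have vx : v^T *m x = 0 by rewrite -vG -mulmxA Gx mulmx0.
  have Lx : L *m x = 0 by rewrite -Gx GE vx mulmx0 addr0.
  have [|c xc] := laplacian_ker P_walk P_conn pi_stat P_rev (x := x).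
    by rewrite /qform -mulmxA Lx mulmx0 mxE.
  have c0 : c = 0.
    move: vx; rewrite xc -scalemxAr vv => /matrixP/(_ 0 0).
    by rewrite !mxE mulr1.
  by rewrite xc c0 scale0r.
have [h Gh] : exists h, G *m h = z by exists (invmx G *m z); rewrite mulKVmx.
have vh : v^T *m h = 0 by rewrite -vG -mulmxA Gh.
by exists h; rewrite -Gh GE vh mulmx0 addr0.
Qed.

(** The kernel of [S L S] is spanned by [S^-1 v], and [a S^-1 h] is a preimage of the rest of [v].
    Weight 0 is allowed, which serves the empty union. *)
Lemma spectral_sum_interpolated M (s : R) h : 0 <= s -> s < 1 ->
  L *m h = centered_state M ->
  spectral_sum (discriminant (interpolated P M s)) v =
  ((1 - Num.sqrt (1 - s)) / (weight pi M + (1 - s) * (1 - weight pi M))) ^+ 2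
    * qform L h.
Proof.
move=> s0 s1 Lh; set r := Num.sqrt (1 - s); set e := weight pi M.
have r_gt0 : 0 < r by rewrite sqrtr_gt0 subr_gt0.
have r2 : r ^+ 2 = 1 - s by rewrite sqr_sqrtr// subr_ge0 ltW.
have e_ge0 : 0 <= e by case: pi_stat => pi_ge0 _ _; rewrite sumr_ge0.
have den0 : e + r ^+ 2 * (1 - e) != 0 by rewrite r2 gt_eqF//; nra.
set a := (1 - r) / _; pose S := rescaling M r; pose S' := rescaling M r^-1.
have S'K (x : 'cV_N) : S *m (S' *m x) = x.
  apply/colP => i; rewrite !mul_diag_mx !mxE; case: ifP => _.
    by rewrite mulVKf// gt_eqF.
  by rewrite !mul1r.
have SK (x : 'cV_N) : S' *m (S *m x) = x.
  apply/colP => i; rewrite !mul_diag_mx !mxE; case: ifP => _.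
    by rewrite mulKf// gt_eqF.
  by rewrite !mul1r.
have SLS : 1%:M - discriminant (interpolated P M s) = S *m L *m S.
  exact: laplacian_interpolated.
have qS x : qform (S *m L *m S) x = qform L (S *m x).
  by rewrite /qform trmx_mul tr_diag_mx !mulmxA.
have -> : a ^+ 2 * qform L h =
    qform (1%:M - discriminant (interpolated P M s)) (a *: (S' *m h)).
  by rewrite SLS qformZ qS S'K.
(* With [c] the coefficient given here, [a] and [c] solve [1 = a r (e - 1) + c / r] on [M] and
   [1 = a e + c] off [M]. *)
apply: (@spectral_sumE _ _ _ _ (S' *m v) _
  (r * (e + r * (1 - e)) / (e + r ^+ 2 * (1 - e)))).
- exact: discriminant_sym.
- by move=> x; rewrite SLS qS (laplacian_ge0 P_walk P_conn pi_stat P_rev).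
- by apply: contra_neq v_neq0 => S'v; rewrite -[LHS]S'K S'v mulmx0.
- by rewrite SLS -!mulmxA S'K (laplacian_sqrt_state P_walk P_conn pi_stat P_rev) mulmx0.
- move=> x; rewrite SLS => Bx.
  have [|b Sx] := laplacian_ker P_walk P_conn pi_stat P_rev (x := S *m x).
    by rewrite -qS /qform -mulmxA Bx mulmx0 mxE.
  by exists b; rewrite -[LHS]SK Sx -scalemxAr.
- rewrite SLS -scalemxAr -!mulmxA S'K Lh; apply/colP => x.
  rewrite !mul_diag_mx !mxE /a -r2 -/e; case: (x \in M); move: (Num.sqrt (pi x 0)) => t.
    by field; rewrite den0 gt_eqF.
  by field.
Qed.

Lemma extended_hitting_timeE M h : 0 < weight pi M ->
  L *m h = centered_state M ->
  extended_hitting_time P pi M = qform L h / weight pi M ^+ 2.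
Proof.
move=> e0 Lh; set e := weight pi M; apply/cvg_lim => //.
pose F (s : R) := ((1 - Num.sqrt (1 - s)) / (e + (1 - s) * (1 - e))) ^+ 2 * qform L h.
have -> : qform L h / e ^+ 2 = F 1.
  by rewrite /F !subrr sqrtr0 subr0 mul0r addr0 mul1r exprVn mulrC.
(* The closed form holds for [0 <= s < 1], hence near 1 from the left; it is continuous at 1 because
   [e > 0]. *)
apply: (@cvg_trans _ (F s @[s --> (1 : R)^'-])%classic).
  apply: near_eq_cvg; near=> s.
  rewrite (spectral_sum_interpolated _ _ Lh)//=.
  near: s; exact: nbhs_left_ge.
apply: cvg_at_left_filter.
have c1 : {for 1, continuous (fun s : R => 1 - s)}.
  by apply: cvgB; [exact: cvg_cst|exact: cvg_id].
apply: cvgMl; rewrite !expr2.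
have Fc : {for 1, continuous (fun s : R =>
    (1 - Num.sqrt (1 - s)) / (e + (1 - s) * (1 - e)))}.
  apply: cvgM.
    apply: cvgB; first exact: cvg_cst.
    by apply: (continuous_comp c1); exact: sqrt_continuous.
  apply: cvgV; first by rewrite subrr mul0r addr0 gt_eqF.
  by apply: cvgD; [exact: cvg_cst|apply: cvgMl; exact: c1].
by apply: cvgM.
Unshelve. all: by end_near.
Qed.

End HittingTime.

(** * The bound for disjoint unions *)

Theorem theorem2 (R : realType) :
  exists2 C : R, 0 < C &
    forall (N : nat) (P : 'M[R]_N) (pi : 'cV[R]_N)
      (I : finType) (Ms : I -> {set 'I_N}) (M : {set 'I_N}),
      random_walk P -> ergodic P ->
      stationary_distribution P pi -> reversible P pi ->
      (forall i, Ms i != finset.set0) ->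
      (forall i j, i != j -> [disjoint Ms i & Ms j]) ->
      M = (\bigcup_(i : I) Ms i)%SET ->
      extended_hitting_time P pi M <=
        C * \sum_i (weight pi (Ms i) / \sum_j weight pi (Ms j))
                     * extended_hitting_time P pi (Ms i).
Proof.
exists 1 => // N P pi I Ms M P_walk [P_conn _] pi_stat P_rev Ms0 Ms_disj ME.
have pi_gt0 := stationary_gt0 P_walk P_conn pi_stat.
have e_gt0 i : 0 < weight pi (Ms i).
  have /set0Pn[x xM] := Ms0 i.
  by rewrite /weight (bigD1 x)//= ltr_pwDl// sumr_ge0// => y _; rewrite ltW.
have sumM (f : 'I_N -> R) : \sum_(x in M) f x = \sum_i \sum_(x in Ms i) f x.
  by rewrite ME; apply: partition_disjoint_bigcup => i j; exact: Ms_disj.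
have eM : weight pi M = \sum_i weight pi (Ms i) by exact: sumM.
(* Writing indicators as sums of Kronecker deltas lets [sumM] give the additivity of
   [marked_state]. *)
have delta_sum (A : {set 'I_N}) x : \sum_(y in A) (x == y)%:R = (x \in A)%:R :> R.
  have [xA|xA] := boolP (x \in A).
    rewrite (bigD1 x)//= eqxx big1 ?addr0// => y /andP[_].
    by rewrite eq_sym => /negPf ->.
  rewrite big1// => y yA; case: eqP => // xy.
  by move: xA; rewrite xy yA.
have markM : marked_state pi M = \sum_i marked_state pi (Ms i).
  apply/colP => x; rewrite summxE mxE.
  have -> : (if x \in M then sqrt_state pi x 0 else 0) =
      \sum_(y in M) (x == y)%:R * sqrt_state pi x 0.
    by rewrite -mulr_suml delta_sum; case: ifP; rewrite ?mul1r ?mul0r.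
  rewrite sumM; apply: eq_bigr => i _.
  by rewrite -mulr_suml delta_sum [RHS]mxE; case: ifP; rewrite ?mul1r ?mul0r.
have [h hE] := choice (fun i => laplacian_preimage P_walk P_conn pi_stat P_rev
  (centered_state_orth P_walk P_conn pi_stat (Ms i))).
pose L := 1%:M - discriminant P.
(* By linearity, the preimages for the parts add up to a preimage for the union. *)
have LH : L *m (\sum_i h i) = centered_state pi M.
  rewrite mulmx_sumr (eq_bigr _ (fun i _ => hE i)) sumrB -scaler_suml.
  by rewrite -eM -markM.
(* For empty [I] the weight of [M] is 0, so the limit is computed directly: the preimage is an empty
   sum, and the spectral sum is 0 near 1. *)
have [i0 _|I0] := pickP (fun _ : I => true); last first.
  rewrite [X in _ <= _ * X]big_pred0 // mulr0.
  rewrite /extended_hitting_time (_ : lim _ = 0)//.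
  apply/cvg_lim => //; apply: (@cvg_trans _ ((0 : R) @[s --> (1 : R)^'-])%classic).
    apply: near_eq_cvg; near=> s.
    rewrite (spectral_sum_interpolated P_walk P_conn pi_stat P_rev _ _ LH)//.
    + by rewrite big_pred0// /qform mulmx0 mxE mulr0.
    + by near: s; exact: nbhs_left_ge.
  exact: cvg_cst.
have E_gt0 : 0 < weight pi M.
  by rewrite eM (bigD1 i0)//= ltr_pwDl// sumr_ge0// => i _; rewrite ltW.
rewrite mul1r -eM (extended_hitting_timeE P_walk P_conn pi_stat P_rev E_gt0 LH).
have L_sym : L^T = L by rewrite linearB/= trmx1 discriminant_sym.
(* The inequality is applied with the weights of the parts as [e]; after clearing
   [weight pi M ^+ 2], the two sides agree term by term. *)
have := psd_form_sum_le h L_sym (laplacian_ge0 P_walk P_conn pi_stat P_rev) e_gt0.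
rewrite -eM => le; rewrite ler_pdivrMr ?exprn_gt0//; apply: le_trans le _.
rewrite mulr_sumr mulr_suml ler_sum// => i _.
rewrite (extended_hitting_timeE P_walk P_conn pi_stat P_rev (e_gt0 i) (hE i)).
rewrite le_eqVlt; apply/orP; left; apply/eqP; rewrite -/L.
by field; rewrite !gt_eqF.
Unshelve. all: by end_near.
Qed.
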